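(* Let $\chi$ be any Dirichlet character of conductor $f$. For every $k\in\mathbb{N}$, $$ \sum_{\nu=2}^{k+1}L_2^{\mathrm{sh}}(k+2-\nu,\nu;\chi,\chi_0)+L_2^{\mathrm{sh}}(1,k+1;\chi_0,\chi)-L_2^{\ast}(1,k+1;\chi_0,\chi)=L(k+2;\chi). $$
   Context: $\mathbb{N}$ is the set of positive integers. A Dirichlet character $\chi$ of conductor $f$ is regarded as a primitive character modulo $f$. $\chi_0$ is the trivial character, $\chi_0(n)=1$ for all $n$. $L(s;\chi)=\sum_{n\geq 1}\chi(n)n^{-s}$ is the Dirichlet $L$-function. For Dirichlet characters $\psi_1,\psi_2$, the double $L$-functions are $$L_2^{\ast}(s_1,s_2;\psi_1,\psi_2)=\sum_{m\geq 1,\, n\geq 1}\frac{\psi_1(m)\psi_2(m+n)}{m^{s_1}(m+n)^{s_2}},\qquad L_2^{\mathrm{sh}}(s_1,s_2;\psi_1,\psi_2)=\sum_{m\geq 1,\, n\geq 1}\frac{\psi_1(m)\psi_2(n)}{m^{s_1}(m+n)^{s_2}}$$ (the superscript $\mathrm{sh}$ stands for the shuffle symbol). *)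

(* Defs.v *)
From HB Require Import structures.
From mathcomp Require Import all_boot all_order all_algebra.
From mathcomp Require Import finmap complex.
From mathcomp Require Import all_classical all_reals all_analysis.

Set Implicit Arguments.
Unset Strict Implicit.
Unset Printing Implicit Defensive.

Import Order.TTheory GRing.Theory Num.Theory.
Import numFieldNormedType.Exports.

Local Open Scope classical_set_scope.
Local Open Scope complex_scope.
Local Open Scope ring_scope.

Definition dirichlet_character (R : realType) (N : nat) (chi : int -> R[i]) :
    Prop :=
  [/\ (0 < N)%N,
      forall a : int, chi (a + N%:Z) = chi a,
      forall a b : int, chi (a * b) = chi a * chi b
    & forall a : int, (chi a != 0) = coprimez a N%:Z].

Definition induced_from (R : realType) (N d : nat) (chi : int -> R[i]) : Prop :=
  exists psi : int -> R[i],
    dirichlet_character d psi /\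
    forall a : int, coprimez a N%:Z -> chi a = psi a.

(* A character of conductor f is identified with the primitive character
   modulo f that induces it. *)
Definition character_of_conductor (R : realType) (f : nat)
    (chi : int -> R[i]) : Prop :=
  dirichlet_character f chi /\
  forall d : nat, (d %| f)%N -> (d < f)%N -> ~ induced_from f d chi.

Definition trivial_character (R : realType) : int -> R[i] := fun=> 1.

(* The finite subsets of I, directed by inclusion: convergence of the finite
   partial sums along [totally] is unconditional convergence. *)
Definition totally {I : choiceType} : set_system {fset I} :=
  filter_from setT (fun A : {fset I} => [set B | (A `<=` B)%fset]).

#[global] Instance totally_filter {I : choiceType} : ProperFilter (@totally I).
Proof.
apply: filter_from_proper; last first.
  by move=> A _; exists A => /=; exact: fsubset_refl.
apply: filter_from_filter; first by exists fset0.
move=> A B _ _; exists (A `|` B)%fset => // D /= ABD.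
by split; apply: fsubset_trans ABD; [exact: fsubsetUl | exact: fsubsetUr].
Qed.

(* The sums below run over m, n >= 1, hence the index shifts. [R[i]^o] is
   [R[i]] as a normed module over itself, which carries the topology. *)
Definition partial_sum2 (R : realType) (u : nat -> nat -> R[i])
    (A : {fset nat * nat}) : R[i]^o :=
  \sum_(p <- A) u p.1.+1 p.2.+1.

Definition converges2 (R : realType) (u : nat -> nat -> R[i]) : Prop :=
  cvg (partial_sum2 u @ totally).

Definition sum2 (R : realType) (u : nat -> nat -> R[i]) : R[i] :=
  lim (partial_sum2 u @ totally).

Definition partial_sum1 (R : realType) (u : nat -> R[i]) : nat -> R[i]^o :=
  series (fun n => u n.+1 : R[i]^o).

Definition converges1 (R : realType) (u : nat -> R[i]) : Prop :=
  cvg (partial_sum1 u @ \oo).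

Definition sum1 (R : realType) (u : nat -> R[i]) : R[i] :=
  lim (partial_sum1 u @ \oo).

Definition L_term (R : realType) (s : nat) (chi : int -> R[i]) (n : nat) :
    R[i] :=
  chi n%:Z / n%:R ^+ s.

Definition L (R : realType) (s : nat) (chi : int -> R[i]) : R[i] :=
  sum1 (L_term s chi).

Definition L2star_term (R : realType) (s1 s2 : nat) (psi1 psi2 : int -> R[i])
    (m n : nat) : R[i] :=
  psi1 m%:Z * psi2 (m + n)%N%:Z / (m%:R ^+ s1 * (m + n)%:R ^+ s2).

Definition L2star (R : realType) (s1 s2 : nat) (psi1 psi2 : int -> R[i]) :
    R[i] :=
  sum2 (L2star_term s1 s2 psi1 psi2).

Definition L2sh_term (R : realType) (s1 s2 : nat) (psi1 psi2 : int -> R[i])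
    (m n : nat) : R[i] :=
  psi1 m%:Z * psi2 n%:Z / (m%:R ^+ s1 * (m + n)%:R ^+ s2).

Definition L2sh (R : realType) (s1 s2 : nat) (psi1 psi2 : int -> R[i]) :
    R[i] :=
  sum2 (L2sh_term s1 s2 psi1 psi2).

(* Main.v *)
Require Import Defs.
From mathcomp Require Import all_boot all_order all_algebra.
From mathcomp Require Import finmap complex cyclic ring lra.
From mathcomp Require Import all_classical all_reals all_analysis.

Import Order.TTheory GRing.Theory Num.Theory.
Import numFieldNormedType.Exports.
Local Open Scope classical_set_scope.
Local Open Scope complex_scope.
Local Open Scope ring_scope.

(** The double series converge absolutely, being dominated by
    1 / (m (m+n)^2), so each may be summed along any exhaustion: the shuffle
    sums along the squares m, n <= N and the stuffle sum along m + n <= N.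
    On a square, a geometric sum in nu and the swap of m and n turn the shuffle
    side into sum_(m <= N) chi(m) / m^k * sum_(n <= N) 1 / (n (m+n)), and the
    inner sum is (H_N + H_m - H_(m+N)) / m; on the triangle the stuffle sum is
    sum_(m <= N) chi(m) H_(m-1) / m^(k+1).  The difference is the N-th partial
    sum of L(k+2; chi), up to an error of modulus at most H_N / N. *)

(** * Unconditional convergence of absolutely bounded families *)

Lemma ge0_sum_fsubset (I : choiceType) (K : numDomainType) (v : I -> K)
    (A B : {fset I}) :
  (forall i, 0 <= v i) -> (A `<=` B)%fset ->
  \sum_(i <- A) v i <= \sum_(i <- B) v i.
Proof.
move=> v0 AB; rewrite (big_fsetID _ (mem A) B) /=.
rewrite (_ : [fset x in B | x \in A]%fset = A); last first.
  by apply/fsetP => x; rewrite !inE /= andb_idl // => /(fsubsetP AB).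
by rewrite lerDl sumr_ge0.
Qed.

(** The finite sums increase with the set, so they converge to their supremum. *)
Lemma ge0_cvg_totally (I : choiceType) (R : realType) (v : I -> R) (B : R) :
  (forall i, 0 <= v i) -> (forall A : {fset I}, \sum_(i <- A) v i <= B) ->
  cvg ((fun A : {fset I} => \sum_(i <- A) v i) @ totally).
Proof.
move=> v0 vB; pose E := range (fun A : {fset I} => \sum_(i <- A) v i).
have supE : has_sup E.
  by split; [exists (\sum_(i <- fset0) v i), fset0|exists B => _ [A _ <-]].
apply/cvg_ex; exists (sup E); apply/cvgrPdist_lt => e e0.
have [_ [A _ <-] Ae] := sup_adherent e0 supE.
exists A => // D AD.
have leD : \sum_(i <- D) v i <= sup E by apply: (ub_le_sup supE.2); exists D.
have := ge0_sum_fsubset I R v A D v0 AD.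
by rewrite ger0_norm; lra.
Qed.

(** [v] is the difference of the nonnegative families [v + |v|] and [|v|], with sums bounded by
    [2 * B] and [B]. *)
Lemma abs_cvg_totally (I : choiceType) (R : realType) (v : I -> R) (B : R) :
  (forall A : {fset I}, \sum_(i <- A) `|v i| <= B) ->
  cvg ((fun A : {fset I} => \sum_(i <- A) v i) @ totally).
Proof.
move=> vB.
have -> : (fun A : {fset I} => \sum_(i <- A) v i) =
    (fun A : {fset I} => \sum_(i <- A) (v i + `|v i|))
    - (fun A : {fset I} => \sum_(i <- A) `|v i|).
  by apply/funext => A; rewrite !fctE -sumrB; apply: eq_bigr => i _; ring.
apply: is_cvgB; last exact: ge0_cvg_totally vB.
apply: (ge0_cvg_totally _ _ _ (2 * B)) => [i|A].
  by have := ler_norm (- v i); rewrite normrN; lra.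
apply: le_trans (ler_wpM2l _ (vB A)) => //; rewrite mulr_sumr.
by apply: ler_sum => i _; have := ler_norm (v i); lra.
Qed.

Lemma norm_complex_le (R : rcfType) (z : R[i]) :
  `|z| <= (`|complex.Re z| + `|complex.Im z|)%:C.
Proof.
rewrite {1}[z]complexE (le_trans (ler_normD _ _)) // normrM rmorphD /=.
have -> : `|'i : R[i]| = 1.
  by rewrite normc_def /= expr0n /= expr1n add0r sqrtr1.
by rewrite mul1r !normc_def /= !expr0n /= !addr0 !sqrtr_sqr.
Qed.

Lemma norm_Im_le (R : rcfType) (z : R[i]) : `|complex.Im z|%:C <= `|z|.
Proof.
case: z => a b; rewrite normc_def lecR /= -sqrtr_sqr ler_wsqrtr //.
by rewrite lerDr sqr_ge0.
Qed.

Lemma abs_cvg_totally_complex (I : choiceType) (R : realType) (u : I -> R[i])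
    (B : R[i]) :
  (forall A : {fset I}, \sum_(i <- A) `|u i| <= B) ->
  cvg ((fun A : {fset I} => \sum_(i <- A) u i : R[i]^o) @ totally).
Proof.
move=> uB.
have bound (g : R[i] -> R) : (forall z, `|g z|%:C <= `|z|) ->
    forall A : {fset I}, \sum_(i <- A) `|g (u i)| <= complex.Re B.
  move=> gle A; suff : (\sum_(i <- A) `|g (u i)|)%:C <= B.
    by rewrite lecE => /andP[].
  rewrite rmorph_sum /=; apply: le_trans (uB A).
  by apply: ler_sum => i _; apply: gle.
have /cvg_ex[a /cvgrPdist_lt acvg] :=
  abs_cvg_totally I R _ _ (bound _ (@normc_ge_Re R)).
have /cvg_ex[b /cvgrPdist_lt bcvg] :=
  abs_cvg_totally I R _ _ (bound _ (norm_Im_le R)).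
apply/cvg_ex; exists (a +i* b); apply/cvgrPdist_lt => e e0.
(* Positive elements of [R[i]] are real, so [e] comes from [R]; the real and imaginary parts get
   half of it each. *)
have [e' ee'] : exists e' : R, e = e'%:C.
  by exists (complex.Re e); rewrite RRe_real // gtr0_real.
rewrite {}ee' in e0 *; rewrite ltcR in e0.
have e20 : 0 < e' / 2 by lra.
near=> A.
apply: le_lt_trans (norm_complex_le _ _) _; rewrite ltcR /=.
have ReS : complex.Re (\sum_(i <- A) u i) = \sum_(i <- A) complex.Re (u i).
  exact: (raddf_sum (@complex.Re R : Rcomplex R -> R)).
have ImS : complex.Im (\sum_(i <- A) u i) = \sum_(i <- A) complex.Im (u i).
  exact: (raddf_sum (@complex.Im R : Rcomplex R -> R)).
have : `|a - \sum_(i <- A) complex.Re (u i)| < e' / 2 by near: A; exact: acvg.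
have : `|b - \sum_(i <- A) complex.Im (u i)| < e' / 2 by near: A; exact: bcvg.
rewrite -ReS -ImS; case: (\sum_(i <- A) u i) => x y /=; lra.
Unshelve. all: by end_near.
Qed.

(** * Exhaustion of the index set by squares and triangles *)

Lemma big_fset_uniq (I : choiceType) (V : nmodType) (s : seq I) (F : I -> V) :
  uniq s -> \sum_(i <- [fset x in s]%fset) F i = \sum_(i <- s) F i.
Proof.
move=> us; apply: perm_big; apply: uniq_perm => // x.
by rewrite !inE.
Qed.

(** Indices are shifted by one: [(m, n)] stands for the term [(m+1, n+1)]. *)
Definition square (N : nat) : {fset nat * nat} :=
  [fset p in [seq (m, n) | m <- iota 0 N, n <- iota 0 N]]%fset.

(** Listed by antidiagonals: [(l, M - l.+1)] stands for the term with m = l + 1 and m + n = M + 1,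
    so [M < N] means m + n <= N. *)
Definition triangle (N : nat) : {fset nat * nat} :=
  [fset p in [seq (l, M - l.+1)%N | M <- iota 0 N, l <- iota 0 M]]%fset.

Lemma mem_square N p : (p \in square N) = (p.1 < N)%N && (p.2 < N)%N.
Proof.
rewrite inE; apply/allpairsP/idP => [[[m n] /= [+ + ->]]|/andP[p1 p2]].
  by rewrite !mem_iota /= !add0n => -> ->.
by exists p; rewrite !mem_iota; case: p p1 p2.
Qed.

Lemma bounded_mem_square N p : (p.1 + p.2.+1 < N)%N -> p \in square N.
Proof.
move=> pN; rewrite mem_square; apply/andP; split; apply: leq_ltn_trans pN.
  exact: leq_addr.
by rewrite addnS ltnW // ltnS leq_addl.
Qed.

Lemma bounded_mem_triangle N p : (p.1 + p.2.+1 < N)%N -> p \in triangle N.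
Proof.
move=> pN; rewrite inE; apply/allpairsPdep; exists (p.1 + p.2.+1)%N, p.1.
rewrite !mem_iota /= !add0n pN addnS ltnS leq_addr; split=> //.
by rewrite subSS addKn; case: p {pN}.
Qed.

Lemma sum_square (V : nmodType) (F : nat * nat -> V) N :
  \sum_(p <- square N) F p = \sum_(0 <= m < N) \sum_(0 <= n < N) F (m, n).
Proof.
rewrite big_fset_uniq; last first.
  by apply: allpairs_uniq => [||[? ?] [? ?]]; rewrite ?iota_uniq.
by rewrite big_allpairs_dep /index_iota !subn0.
Qed.

Lemma sum_triangle (V : nmodType) (F : nat * nat -> V) N :
  \sum_(p <- triangle N) F p =
  \sum_(0 <= M < N) \sum_(0 <= l < M) F (l, M - l.+1)%N.
Proof.
rewrite big_fset_uniq; last first.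
  apply: allpairs_uniq_dep => [||]; rewrite ?iota_uniq //.
    by move=> *; rewrite iota_uniq.
  (* [l] is the first coordinate; adding [l.+1] to the second recovers [M], without truncation as
     [l < M]. *)
  move=> _ _ /allpairsPdep[M [l [_ + ->]]] /allpairsPdep[M' [l' [_ + ->]]] /=.
  rewrite !mem_iota /= !add0n => lM lM' [ll']; subst l'.
  move=> /eqP; rewrite -(eqn_add2r l.+1) !subnK // => /eqP MM'.
  by rewrite MM'.
rewrite big_allpairs_dep /index_iota !subn0; apply: eq_bigr => M _.
by rewrite subn0.
Qed.

Lemma fset_bounded (A : {fset nat * nat}) :
  exists N, forall p, p \in A -> (p.1 + p.2.+1 < N)%N.
Proof.
exists (\sum_(p <- A) (p.1 + p.2.+1)).+1 => p pA.
by rewrite ltnS (big_fsetD1 p) //= leq_addr.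
Qed.

(** A finite set of indices is bounded, hence inside [S N] for all large N. *)
Lemma cvg_totally_exhaust (S : nat -> {fset nat * nat}) :
  (forall N p, (p.1 + p.2.+1 < N)%N -> p \in S N) -> S @ \oo --> totally.
Proof.
move=> HS X [A _ AX]; have [N AN] := fset_bounded A.
exists N => // n /= Nn; apply: AX; apply/fsubsetP => p pA.
by apply: HS; apply: leq_trans Nn; apply: AN.
Qed.

Lemma cvg_square : square @ \oo --> totally.
Proof. by apply: cvg_totally_exhaust => N p; apply: bounded_mem_square. Qed.

Lemma cvg_triangle : triangle @ \oo --> totally.
Proof. by apply: cvg_totally_exhaust => N p; apply: bounded_mem_triangle. Qed.

Lemma cvg_sum2 (R : realType) (u : nat -> nat -> R[i])
    (S : nat -> {fset nat * nat}) :
  S @ \oo --> totally -> converges2 u ->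
  (fun N => partial_sum2 u (S N)) @ \oo --> (sum2 u : R[i]^o).
Proof. by move=> Scvg ucvg; apply: cvg_comp Scvg ucvg. Qed.

(** * Values of a Dirichlet character have modulus at most 1 *)

Section DirichletCharacter.
Variables (R : realType) (N : nat) (chi : int -> R[i]).
Hypothesis hchi : dirichlet_character N chi.

Lemma dirichlet_character1 : chi 1 = 1.
Proof.
have [_ _ chiM chi0] := hchi.
have chi1 : chi 1 != 0 by rewrite chi0 coprimezE coprime1n.
by apply: (mulfI chi1); rewrite -chiM !mulr1.
Qed.

Lemma dirichlet_character_mod (n : nat) : chi (n %% N)%N%:Z = chi n%:Z.
Proof.
have [_ chiD _ _] := hchi.
rewrite {2}(divn_eq n N); elim: (n %/ N)%N => [|q ->].
  by rewrite mul0n add0n.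
by rewrite mulSn -addnA [in RHS]addnC [in RHS]PoszD chiD.
Qed.

Lemma dirichlet_characterX (n t : nat) : chi (n ^ t)%N%:Z = chi n%:Z ^+ t.
Proof.
have [_ _ chiM _] := hchi.
elim: t => [|t IH]; first by rewrite expn0 expr0 dirichlet_character1.
by rewrite expnS PoszM chiM IH exprS.
Qed.

(** By Euler's theorem a nonzero value is a root of unity. *)
Lemma norm_dirichlet_character_le1 (n : nat) : `|chi n%:Z| <= 1.
Proof.
have [N0 _ _ chi0] := hchi.
have [->|] := eqVneq (chi n%:Z) 0; first by rewrite normr0.
rewrite chi0 => nN.
have chiX1 : chi n%:Z ^+ totient N = 1.
  rewrite -dirichlet_characterX -dirichlet_character_mod.
  by rewrite Euler_exp_totient // dirichlet_character_mod dirichlet_character1.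
have : `|chi n%:Z| ^+ totient N == 1 by rewrite -normrX chiX1 normr1.
rewrite pexprn_eq1 // => /orP[|/eqP -> //].
by rewrite -[_ == _]/(totient N == 0)%N -leqn0 leqNgt totient_gt0 N0.
Qed.

End DirichletCharacter.

(** * Finite sums: the majorant, the geometric sum in nu, harmonic numbers *)

Section DoubleSums.
Variable K : numFieldType.
Implicit Types (a b m n N : nat) (x y z : K).

Definition harm N : K := \sum_(0 <= i < N) i.+1%:R^-1.

Lemma sum_inv_sq_le a n : (0 < a)%N ->
  \sum_(0 <= j < n) (a + j.+1)%:R ^- 2 <= a%:R^-1 :> K.
Proof.
(* The telescoping form, from 1/(d+1)^2 <= 1/d - 1/(d+1), is the one that induction can prove. *)
move=> a0; suff : \sum_(0 <= j < n) (a + j.+1)%:R ^- 2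
    <= a%:R^-1 - (a + n)%:R^-1 :> K.
  by move=> /le_trans; apply; rewrite gerBl invr_ge0 ler0n.
elim: n => [|n IH]; first by rewrite big_nil addn0 subrr.
rewrite big_nat_recr //=; apply: le_trans (lerD IH (lexx _)) _.
have d0 : 0 < (a + n)%:R :> K by rewrite ltr0n addn_gt0 a0.
rewrite addnS -natr1; move: ((a + n)%:R) d0 => d d0.
have d1 : 0 < d + 1 by rewrite addr_gt0.
rewrite -subr_ge0; have -> : a%:R^-1 - (d + 1)^-1
    - (a%:R^-1 - d^-1 + (d + 1) ^- 2) = d^-1 * (d + 1) ^- 2.
  have aN : a%:R != 0 :> K by rewrite pnatr_eq0 -lt0n.
  by field; rewrite aN !gt_eqF.
by rewrite mulr_ge0 ?invr_ge0 ?exprn_ge0 // ltW.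
Qed.

Definition majorant (p : nat * nat) : K :=
  (p.1.+1%:R * (p.1.+1 + p.2.+1)%:R ^+ 2)^-1.

Lemma majorant_ge0 p : 0 <= majorant p.
Proof. by rewrite invr_ge0 mulr_ge0 // exprn_ge0. Qed.

(** For fixed m the sum over n is at most 1/m^2; the sum of 1/m^2 is at most 1 + 1, first term plus
    tail. *)
Lemma sum_majorant_le (A : {fset nat * nat}) : \sum_(p <- A) majorant p <= 2.
Proof.
have [N AN] := fset_bounded A.
have AS : (A `<=` square N)%fset.
  by apply/fsubsetP => p /AN; exact: bounded_mem_square.
apply: le_trans (ge0_sum_fsubset _ _ _ _ _ majorant_ge0 AS) _.
rewrite sum_square.
apply: (@le_trans _ _ (\sum_(0 <= m < N) m.+1%:R ^- 2)).
  apply: ler_sum => m _; rewrite /majorant /=.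
  under eq_bigr do rewrite invfM.
  rewrite -mulr_sumr expr2 invfM ler_wpM2l ?invr_ge0 //.
  exact: sum_inv_sq_le.
case: N {AN AS} => [|N]; first by rewrite big_nil.
rewrite big_nat_recl //= expr1n invr1 [2](_ : _ = 1 + 1) // lerD2l.
by have := sum_inv_sq_le 1 N isT; rewrite invr1.
Qed.

(** A geometric sum of ratio a/b: as b - a = n, it equals (1/(a^k b) - 1/b^(k+1)) / n, and the added
    term cancels the part in b^(k+1). *)
Lemma sum_inv_geometric a b n k : (0 < a)%N -> (0 < n)%N -> b = (a + n)%N ->
  \sum_(2 <= nu < k.+2) (a%:R ^+ (k + 2 - nu) * b%:R ^+ nu)^-1
    + (n%:R * b%:R ^+ (k + 1))^-1 = (a%:R ^+ k * n%:R * b%:R)^-1 :> K.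
Proof.
move=> a0 n0 ->.
have aN : a%:R != 0 :> K by rewrite pnatr_eq0 -lt0n.
have nN : n%:R != 0 :> K by rewrite pnatr_eq0 -lt0n.
have bN : a%:R + n%:R != 0 :> K.
  by rewrite -natrD pnatr_eq0 addn_eq0 negb_and -lt0n a0.
rewrite natrD; elim: k => [|k IH].
  by rewrite big_geq // add0r expr0 mul1r add0n expr1.
rewrite big_nat_recr //=.
(* From k to k + 1 every old term gains a factor 1/a, and the new term nu = k + 2 has a to the first
   power. *)
under eq_big_nat => nu /andP[_ nuk].
  rewrite addSn subSn ?exprS; last by rewrite addn2 ltnW.
  rewrite -mulrA invfM; over.
rewrite -mulr_sumr (_ : (k.+1 + 2 - k.+2 = 1)%N); last first.
  by rewrite addn2 subSn // subnn.
move/(canRL (addrK _)): IH => ->.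
rewrite addSn addn1 !exprS expr0.
have aX : (a%:R : K) ^+ k != 0 by rewrite expf_neq0.
have bX : (a%:R + n%:R : K) ^+ k != 0 by rewrite expf_neq0.
by field; rewrite aN nN bN aX bX.
Qed.

Lemma harmD m N : harm (m + N) = harm m + \sum_(0 <= n < N) (m + n.+1)%:R^-1.
Proof.
rewrite /harm (big_cat_nat (n := m)) ?leq_addr //=; congr +%R.
rewrite -{1}[m]add0n big_addn addnC addnK.
by apply: eq_bigr => i _; rewrite addnS addnC.
Qed.

(** Partial fractions: 1/(b (a+b)) = (1/b - 1/(a+b)) / a. *)
Lemma sum_inv_mul_shift m N :
  \sum_(0 <= n < N) (n.+1%:R * (m.+1 + n.+1)%:R)^-1 =
  m.+1%:R^-1 * (harm N + harm m.+1 - harm (m.+1 + N)) :> K.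
Proof.
rewrite harmD opprD addrA addrK /harm -sumrB mulr_sumr.
apply: eq_bigr => n _; rewrite natrD.
have bN : m.+1%:R + n.+1%:R != 0 :> K by rewrite -natrD pnatr_eq0 addSn.
move: bN; have: m.+1%:R != 0 :> K by rewrite pnatr_eq0.
have: n.+1%:R != 0 :> K by rewrite pnatr_eq0.
move: (m.+1%:R) (n.+1%:R) => a b b0 a0 ab0.
by field; rewrite a0 b0 ab0.
Qed.

(** The difference consists of [m] reciprocals, each at most 1/N. *)
Lemma harm_diff_bound m N : (0 < N)%N ->
  `|harm (m + N) - harm N| <= m%:R / N%:R :> K.
Proof.
move=> N0; rewrite addnC harmD addrAC subrr add0r ger0_norm ?sumr_ge0 //.
rewrite -[m%:R]/(1 *+ m) -{2}[m]subn0 -sumr_const_nat mulr_suml.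
apply: ler_sum => n _; rewrite mul1r lef_pV2 ?posrE ?ltr0n ?addnS //.
by rewrite ler_nat -addnS leq_addr.
Qed.

(** The term of index m has modulus at most 1/((m+1)^k N), and k >= 1 bounds this by 1/((m+1) N). *)
Lemma harm_diff_sum_bound (c : nat -> K) k N :
  (forall m, `|c m| <= 1) -> (0 < k)%N ->
  `|\sum_(0 <= m < N) c m / m.+1%:R ^+ (k + 1) * (harm (m.+1 + N) - harm N)|
    <= N%:R^-1 * harm N.
Proof.
move=> c1 k0; case: N => [|N]; first by rewrite /harm !big_nil normr0 mulr0.
apply: le_trans (ler_norm_sum _ _ _) _; rewrite mulr_sumr.
apply: ler_sum => m _; rewrite !normrM normfV normrX (ger0_norm (ler0n _ m.+1)).
apply: (@le_trans _ _ (m.+1%:R ^- (k + 1) * (m.+1%:R / N.+1%:R))).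
  apply: ler_pM; rewrite ?harm_diff_bound ?mulr_ge0 ?invr_ge0 ?exprn_ge0 //.
  by rewrite ler_piMl ?invr_ge0 ?exprn_ge0.
rewrite mulrA [leLHS]mulrC ler_wpM2l ?invr_ge0 // addn1 exprS invfM mulrAC.
rewrite mulVf ?pnatr_eq0 // mul1r lef_pV2 ?posrE ?exprn_gt0 ?ltr0n //.
rewrite -natrX ler_nat; case: k k0 => // k _.
by rewrite expnS leq_pmulr ?expn_gt0.
Qed.

End DoubleSums.

(** * Vanishing of the error and convergence of the double series *)

Lemma cvg0_harm_mean (R : realType) (x : nat -> R[i]) :
  (forall N, `|x N| <= N%:R^-1 * harm _ N) ->
  (x : nat -> R[i]^o) @ \oo --> (0 : R[i]^o).
Proof.
move=> xle; pose g n : R := n%:R^-1 * series harmonic n.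
(* H_N / N is a Cesaro mean of the harmonic sequence, which tends to 0; the shift makes the divisor
   n + 1. *)
have : g @ \oo --> 0 by rewrite -cvg_shiftS; exact: cesaro cvg_harmonic.
move=> /cvgrPdist_lt gcvg; apply/cvgrPdist_lt => e e0.
have [e' ee'] : exists e' : R, e = e'%:C.
  by exists (complex.Re e); rewrite RRe_real // gtr0_real.
rewrite {}ee' in e0 *; rewrite ltcR in e0.
near=> N.
rewrite sub0r normrN; apply: le_lt_trans (xle N) _.
have -> : N%:R^-1 * harm _ N = (g N)%:C.
  rewrite rmorphM fmorphV rmorph_nat /series /= rmorph_sum; congr (_ * _).
  by apply: eq_bigr => i _; rewrite /= fmorphV rmorph_nat.
rewrite ltcR; apply: le_lt_trans (ler_norm _) _.
rewrite -normrN -sub0r; near: N; exact: gcvg.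
Unshelve. all: by end_near.
Qed.

Lemma converges2_majorant (R : realType) (u : nat -> nat -> R[i]) :
  (forall p, `|u p.1.+1 p.2.+1| <= majorant _ p) -> converges2 u.
Proof.
move=> uM; apply: (abs_cvg_totally_complex _ _ (fun p => u p.1.+1 p.2.+1) 2).
move=> A; apply: le_trans (sum_majorant_le _ A).
by apply: ler_sum => p _; exact: uM.
Qed.

(** Raising the exponents above 1 and 2 only enlarges the denominator, as its bases are at least
    1. *)
Lemma norm_term_majorant (K : numFieldType) (s1 s2 : nat) (c1 c2 : K) p :
  (0 < s1)%N -> (1 < s2)%N -> `|c1| <= 1 -> `|c2| <= 1 ->
  `|c1 * c2 / (p.1.+1%:R ^+ s1 * (p.1.+1 + p.2.+1)%:R ^+ s2)| <= majorant _ p.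
Proof.
move=> s10 s21 c11 c21; rewrite normrM normfV.
rewrite (ger0_norm (_ : 0 <= _ ^+ _ * _)); last first.
  by rewrite mulr_ge0 ?exprn_ge0.
rewrite -[leRHS]mul1r ler_pM ?invr_ge0 ?mulr_ge0 ?exprn_ge0 //.
  by rewrite normrM -[leRHS]mul1r ler_pM.
have ge1 n : 1 <= n.+1%:R :> K by rewrite ler1n.
rewrite lef_pV2 ?posrE ?mulr_gt0 ?exprn_gt0 ?ltr0n //.
rewrite ler_pM ?exprn_ge0 //; last by rewrite addSn ler_weXn2l.
by rewrite -{1}[_%:R]expr1 ler_weXn2l.
Qed.

(** * The identity for finite sums *)

Section MainIdentity.
Variables (R : realType) (chi : int -> R[i]) (k : nat).
Let chi0 := trivial_character R.

Lemma sum_square_L2sh N :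
  \sum_(2 <= nu < k.+2)
      partial_sum2 (L2sh_term (k + 2 - nu) nu chi chi0) (square N)
    + partial_sum2 (L2sh_term 1 (k + 1) chi0 chi) (square N)
  = \sum_(0 <= m < N) chi m.+1%:Z / m.+1%:R ^+ (k + 1)
      * (harm _ N + harm _ m.+1 - harm _ (m.+1 + N)).
Proof.
(* Swapping m and n puts chi on m, as in the other shuffle sums. *)
have -> : partial_sum2 (L2sh_term 1 (k + 1) chi0 chi) (square N) =
    \sum_(0 <= m < N) \sum_(0 <= n < N)
      chi m.+1%:Z * (n.+1%:R * (m.+1 + n.+1)%:R ^+ (k + 1))^-1.
  rewrite /partial_sum2 sum_square exchange_big /=.
  apply: eq_bigr => m _; apply: eq_bigr => n _.
  by rewrite /L2sh_term /chi0 /trivial_character mul1r expr1 addnC.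
under eq_bigr => nu _ do rewrite /partial_sum2 sum_square /=.
rewrite exchange_big -big_split /=; apply: eq_bigr => m _.
rewrite exchange_big -big_split /=.
(* Of m^(k+1), one factor m goes to the partial fractions and m^k to the geometric sum. *)
rewrite [in RHS]addn1 exprSr invfM mulrA -[RHS]mulrA.
rewrite -sum_inv_mul_shift mulr_sumr.
apply: eq_bigr => n _.
under eq_bigr => nu _ do
  rewrite /L2sh_term /chi0 /trivial_character mulr1.
rewrite -mulr_sumr -mulrDr sum_inv_geometric //.
by rewrite -mulrA -mulrA -invfM mulrA.
Qed.

(** On the antidiagonal m + n = M + 1 the value of chi and the power of m + n are constant, leaving
    the sum of 1/m over m <= M. *)
Lemma sum_triangle_L2star N :
  partial_sum2 (L2star_term 1 (k + 1) chi0 chi) (triangle N)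
  = \sum_(0 <= m < N) chi m.+1%:Z / m.+1%:R ^+ (k + 1) * harm _ m.
Proof.
rewrite /partial_sum2 sum_triangle; apply: eq_bigr => M _.
rewrite /harm mulr_sumr; apply: eq_big_nat => l /andP[_ lM] /=.
rewrite /L2star_term /chi0 /trivial_character mul1r expr1.
by rewrite addnS subnKC // invfM [_^-1 * _]mulrC mulrA.
Qed.

Lemma partial_sum_identity N :
  partial_sum1 (L_term (k + 2) chi) N
  = \sum_(2 <= nu < k.+2)
        partial_sum2 (L2sh_term (k + 2 - nu) nu chi chi0) (square N)
    + partial_sum2 (L2sh_term 1 (k + 1) chi0 chi) (square N)
    - partial_sum2 (L2star_term 1 (k + 1) chi0 chi) (triangle N)
    + \sum_(0 <= m < N) chi m.+1%:Z / m.+1%:R ^+ (k + 1)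
        * (harm _ (m.+1 + N) - harm _ N).
Proof.
rewrite sum_square_L2sh sum_triangle_L2star -sumrB -big_split /=.
rewrite /partial_sum1 /series /=; apply: eq_bigr => m _.
(* The extra 1/(m+1) in H_(m+1) - H_m supplies the term of L. *)
rewrite /L_term (_ : harm _ m.+1 = harm _ m + m.+1%:R^-1); last first.
  by rewrite /harm big_nat_recr.
rewrite addn2 addn1 (exprS _ k.+1); move: (_ ^+ _) => d.
by rewrite invfM; ring.
Qed.

End MainIdentity.

Theorem corollary1p3 (R : realType) (f : nat) (chi : int -> R[i])
    (hchi : character_of_conductor f chi) (k : nat) (hk : (0 < k)%N) :
  let chi0 := trivial_character R in
  [/\ forall nu : nat, (2 <= nu < k.+2)%N ->
        converges2 (L2sh_term (k + 2 - nu) nu chi chi0),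
      converges2 (L2sh_term 1 (k + 1) chi0 chi),
      converges2 (L2star_term 1 (k + 1) chi0 chi),
      converges1 (L_term (k + 2) chi)
    & \sum_(2 <= nu < k.+2) L2sh (k + 2 - nu) nu chi chi0
        + L2sh 1 (k + 1) chi0 chi - L2star 1 (k + 1) chi0 chi
      = L (k + 2) chi].
Proof.
move=> chi0.
have chi_le1 (n : nat) : `|chi n%:Z| <= 1.
  exact: norm_dirichlet_character_le1 hchi.1 n.
have chi0_le1 (n : nat) : `|chi0 n%:Z| <= 1 by rewrite normr1.
have conv_sh nu : (2 <= nu < k.+2)%N ->
    converges2 (L2sh_term (k + 2 - nu) nu chi chi0).
  move=> /andP[nu2 nuk]; apply: converges2_majorant => p.
  (* Here nu <= k + 1 keeps the first exponent positive. *)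
  by apply: norm_term_majorant; rewrite ?subn_gt0 ?addn2.
have conv_sh1 : converges2 (L2sh_term 1 (k + 1) chi0 chi).
  apply: converges2_majorant => p.
  by apply: norm_term_majorant; rewrite ?addn1.
have conv_star : converges2 (L2star_term 1 (k + 1) chi0 chi).
  apply: converges2_majorant => p.
  by apply: norm_term_majorant; rewrite ?addn1.
(* Convergence of the L-series comes with its value: by the finite identity its partial sums combine
   convergent sequences. *)
have cvgL : partial_sum1 (L_term (k + 2) chi) @ \oo -->
    (\sum_(2 <= nu < k.+2) L2sh (k + 2 - nu) nu chi chi0
        + L2sh 1 (k + 1) chi0 chi - L2star 1 (k + 1) chi0 chi : R[i]^o).
  have cvg_err := cvg0_harm_mean _ _
    (fun N => harm_diff_sum_bound _ _ k N (fun m => chi_le1 m.+1) hk).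
  have cvg_sh1 := cvg_sum2 _ _ _ cvg_square conv_sh1.
  have cvg_star := cvg_sum2 _ _ _ cvg_triangle conv_star.
  have cvg_sh : (fun N => \sum_(2 <= nu < k.+2)
      partial_sum2 (L2sh_term (k + 2 - nu) nu chi chi0) (square N)) @ \oo -->
      (\sum_(2 <= nu < k.+2) L2sh (k + 2 - nu) nu chi chi0 : R[i]^o).
    (* The range of nu is kept as a condition, because [conv_sh] asks for it. *)
    rewrite big_nat_cond; under eq_cvg do rewrite big_nat_cond.
    apply: cvg_big => [|nu]; first exact: add_continuous.
    by rewrite andbT => /conv_sh; exact: cvg_sum2 cvg_square.
  have cvg_all := cvgD (cvgB (cvgD cvg_sh cvg_sh1) cvg_star) cvg_err.
  rewrite addr0 in cvg_all.
  by rewrite (funext (partial_sum_identity R chi k)); exact: cvg_all.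
split; [exact: conv_sh|exact: conv_sh1|exact: conv_star| |].
  by apply/cvg_ex; eexists; exact: cvgL.
by apply/esym; apply: cvg_lim cvgL; exact: norm_hausdorff.
Qed.
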